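(* Let $M$ be a matroid with rank function $\rho$. Let $K_k\lessdot K_{k+1}\lessdot\dots\lessdot K_n$ and $L_l\lessdot L_{l+1}\lessdot\dots\lessdot L_n$ be flags of flats in $M$ such that $K_n=L_n$, $\rho(K_i)=i$ and $\rho(L_j)=j$. Let $D_i=K_i\setminus K_{i-1}$ for $i=k+1,\dots,n$, $E_l=L_l$, and $E_j=L_j\setminus L_{j-1}$ for $j=l+1,\dots,n$. In $\widetilde S(M)$ (and hence also in $S(M)$), the flag path $$(K_k\lessdot K_{k+1}\lessdot\dots\lessdot K_n=L_n\gtrdot L_{n-1}\gtrdot\dots\gtrdot L_l)$$ is equal to zero if $(K_i,L_j)$ is not a modular pair for some $i$ and $j$. Otherwise, the function $\sigma_{K,L}(i):=\min\{j\mid D_i\cap E_j\ne\varnothing\}$ ($i=k+1,\dots,n$) defines a double coset $\sigma_{K,L}\in\mathfrak S_k\backslash\mathfrak S_n/\mathfrak S_l$, and if $(K_i,L_j)$ is modular for all $i$ and $j$ then $$(K_k\lessdot K_{k+1}\lessdot\dots\lessdot K_n=L_n\gtrdot L_{n-1}\gtrdot\dots\gtrdot L_l)=\mathrm{sgn}(\sigma_{K,L})\cdot\prod_i|D_i\cap E_{\sigma_{K,L}(i)}|\cdot F,$$ where $\mathrm{sgn}(\sigma_{K,L})$ is the sign of the minimal (length) coset representative of $\sigma_{K,L}$, the product runs over all $i=k+1,\dots,n$ such that $\sigma_{K,L}(i)>l$, and $F$ is the flag path obtained from the sequence of flats $$(K_k,\ K_k\cap L_{n-1},\ \dots,\ K_k\cap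 L_{l+1},\ K_k\cap L_l,\ K_{k+1}\cap L_l,\ \dots,\ K_{n-1}\cap L_l,\ L_l)$$ by removing any consecutive repetitions.
   Context: $M$ is a matroid on a finite ground set with lattice of flats $\mathcal L$ ordered by inclusion and rank function $\rho$. For flats write $K\lessdot L$ (or $L\gtrdot K$) if $L$ covers $K$. Flats $X,Y$ form a modular pair if $\rho(X)+\rho(Y)=\rho(X\vee Y)+\rho(X\cap Y)$, where $X\vee Y$ is the smallest flat containing $X\cup Y$. A flag path is a finite nonempty sequence $(K_1,\dots,K_l)$ of flats with $K_i\lessdot K_{i+1}$ or $K_i\gtrdot K_{i+1}$ for each $i<l$ (commas may be replaced by these symbols). The free $\mathbb Z$-module on flag paths is an algebra under concatenation: $(K_1,\dots,K_l)\cdot(L_1,\dots,L_{l'})=(K_1,\dots,K_l=L_1,L_2,\dots,L_{l'})$ if $K_l=L_1$ and $0$ otherwise. Let $\widetilde S(M)$ be the quotient of this algebra by the two-sided ideal generated by the relations ($\bigwedge$) for $K\lessdot L$ and $K'\lessdot L$: $(K\lessdot L\gtrdot K')$ equals $|L\setminus K|\,(K)$ if $K=K'$; $-(K\gtrdot K\cap K'\lessdot K')$ if $K\ne K'$ and $K\cap K'\lessdot K$; and $0$ otherwise. $S(M)$ is the quotient of $\widetilde S(M)$ by the further relations (FS): for flats $L<K$ with $\rho(K)=\rho(L)+2$, $\sum_X(L\lessdot X\lessdot K)=0=\sum_X(K\gtrdot X\gtrdot L)$, sums over flats $X$ with $K\gtrdot X\gtrdot L$. Double coset convention: the double coset determined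 by $\sigma_{K,L}$ is the set of permutations $w\in\mathfrak S_n$, up to permuting the arguments in $\{1,\dots,k\}$ and the values in $\{1,\dots,l\}$, such that for $i=k+1,\dots,n$ one has $w(i)=\sigma_{K,L}(i)$ if $\sigma_{K,L}(i)>l$ and $w(i)\in\{1,\dots,l\}$ if $\sigma_{K,L}(i)=l$. *)

(* Defs.v *)
From HB Require Import structures.
From mathcomp Require Import all_boot all_order all_algebra all_fingroup.
From mathcomp Require Import generic_quotient ring_quotient.
From mathcomp Require Import boolp.
From mathcomp.multinomials Require Import freeg.

Set Implicit Arguments.
Unset Strict Implicit.
Unset Printing Implicit Defensive.

Import GRing.Theory.

Local Open Scope ring_scope.
Local Open Scope quotient_scope.

Section RingQuotient.
Variables (R : pzRingType) (G : R -> Prop).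

Inductive gen_ideal : R -> Prop :=
| gen_ideal_in x of G x : gen_ideal x
| gen_ideal0 : gen_ideal 0
| gen_idealD x y of gen_ideal x & gen_ideal y : gen_ideal (x + y)
| gen_idealMl a x of gen_ideal x : gen_ideal (a * x)
| gen_idealMr x a of gen_ideal x : gen_ideal (x * a).

Definition gen_ideal_pred : {pred R} := fun x => `[< gen_ideal x >].

Lemma gen_ideal_zmod_closed : zmod_closed gen_ideal_pred.
Proof.
split; first by apply/asboolP; exact: gen_ideal0.
move=> x y /asboolP Ix /asboolP Iy; apply/asboolP; apply: gen_idealD => //.
by rewrite -mulN1r; apply: gen_idealMl.
Qed.

HB.instance Definition _ :=
  GRing.isZmodClosed.Build R gen_ideal_pred gen_ideal_zmod_closed.

Definition ring_quot : Type :=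
  Quotient.quot (gen_ideal_pred : zmodClosed R).

HB.instance Definition _ := GRing.Zmodule.on ring_quot.
HB.instance Definition _ := ZmodQuotient.on ring_quot.

Lemma ring_quotP x y :
  reflect (\pi_ring_quot x = \pi_ring_quot y) `[< gen_ideal (x - y) >].
Proof.
have -> : `[< gen_ideal (x - y) >] = (x - y \in gen_ideal_pred) by [].
by rewrite Quotient.idealrBE; apply: eqP.
Qed.

Definition ring_quot_one : ring_quot := \pi_ring_quot 1.
Definition ring_quot_mul (x y : ring_quot) : ring_quot :=
  \pi_ring_quot (repr x * repr y).

Lemma pi_ring_quotM x y :
  ring_quot_mul (\pi_ring_quot x) (\pi_ring_quot y) = \pi_ring_quot (x * y).
Proof.
apply/ring_quotP/asboolP.
have memr z : gen_ideal (repr (\pi_ring_quot z) - z).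
  by apply/asboolP/ring_quotP; rewrite reprK.
set x' := repr _; set y' := repr _.
have -> : x' * y' - x * y = (x' - x) * y' + x * (y' - y).
  by rewrite mulrBl mulrBr addrA subrK.
by apply: gen_idealD; [apply: gen_idealMr | apply: gen_idealMl]; exact: memr.
Qed.

Let pi_surj (x : ring_quot) : {y | x = \pi_ring_quot y}.
Proof. by exists (repr x); rewrite reprK. Qed.

Let piD x y : \pi_ring_quot (x + y) = \pi_ring_quot x + \pi_ring_quot y.
Proof. by rewrite piE. Qed.

Lemma ring_quot_mulA : associative ring_quot_mul.
Proof.
move=> x y z; have [{}x ->] := pi_surj x; have [{}y ->] := pi_surj y.
by have [{}z ->] := pi_surj z; rewrite !pi_ring_quotM mulrA.
Qed.

Lemma ring_quot_mul1 : left_id ring_quot_one ring_quot_mul.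
Proof. by move=> x; have [{}x ->] := pi_surj x; rewrite pi_ring_quotM mul1r. Qed.

Lemma ring_quot_1mul : right_id ring_quot_one ring_quot_mul.
Proof. by move=> x; have [{}x ->] := pi_surj x; rewrite pi_ring_quotM mulr1. Qed.

Lemma ring_quot_mulDl : left_distributive ring_quot_mul +%R.
Proof.
move=> x y z; have [{}x ->] := pi_surj x; have [{}y ->] := pi_surj y.
by have [{}z ->] := pi_surj z; rewrite -piD !pi_ring_quotM -piD mulrDl.
Qed.

Lemma ring_quot_mulDr : right_distributive ring_quot_mul +%R.
Proof.
move=> x y z; have [{}x ->] := pi_surj x; have [{}y ->] := pi_surj y.
by have [{}z ->] := pi_surj z; rewrite -piD !pi_ring_quotM -piD mulrDr.
Qed.

HB.instance Definition _ := GRing.Zmodule_isPzRing.Build ring_quot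
  ring_quot_mulA ring_quot_mul1 ring_quot_1mul ring_quot_mulDl ring_quot_mulDr.

Lemma pi_ring_quot_zmod_morphism : zmod_morphism (\pi_ring_quot : R -> _).
Proof. by move=> x y /=; rewrite !piE. Qed.

Lemma pi_ring_quot_monoid_morphism : monoid_morphism (\pi_ring_quot : R -> _).
Proof. by split=> // x y; rewrite [RHS]pi_ring_quotM. Qed.

HB.instance Definition _ := GRing.isMonoidMorphism.Build R ring_quot
  \pi_ring_quot pi_ring_quot_monoid_morphism.

End RingQuotient.

Record matroid (E : finType) := Matroid {
  rk : {set E} -> nat;
  rk_le_card : forall A : {set E}, (rk A <= #|A|)%N;
  rk_mono : forall A B : {set E}, A \subset B -> (rk A <= rk B)%N;
  rk_submod : forall A B : {set E},
    (rk (A :|: B) + rk (A :&: B) <= rk A + rk B)%N }.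

Section Flats.
Variables (E : finType) (M : matroid E).

Definition is_flat (F : {set E}) : bool :=
  [forall x, (x \notin F) ==> (rk M F < rk M (x |: F))%N].

Record flat := Flat { flat_set :> {set E}; _ : is_flat flat_set }.

HB.instance Definition _ := [isSub for flat_set].
HB.instance Definition _ := [Finite of flat by <:].

Lemma is_flatT : is_flat [set: E].
Proof. by apply/forallP => x; rewrite inE. Qed.

Lemma is_flatI (F G : {set E}) : is_flat F -> is_flat G -> is_flat (F :&: G).
Proof.
have half (A B : {set E}) x : is_flat A -> x \notin A ->
    (rk M (A :&: B) < rk M (x |: (A :&: B)))%N.
  move=> /forallP/(_ x)/implyP flA xA; move: (flA xA) => lt.
  have := rk_submod M A (x |: (A :&: B)).
  have -> : A :|: (x |: A :&: B) = x |: A.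
    by rewrite setUCA; congr (_ :|: _); apply/setUidPl; exact: subsetIl.
  have -> : A :&: (x |: A :&: B) = A :&: B.
    apply/setP => y; rewrite !inE; case: eqP => [->|_]; first by rewrite (negPf xA).
    by rewrite /= andbA andbb.
  by move=> sub; rewrite -(ltn_add2l (rk M A)) (leq_trans _ sub) // ltn_add2r.
move=> flF flG; apply/forallP => x; apply/implyP; rewrite inE negb_and.
by case/orP => xN; [exact: half | rewrite setIC; exact: half].
Qed.

Definition flatT : flat := Flat is_flatT.
Definition flatI (K L : flat) : flat := Flat (is_flatI (valP K) (valP L)).

Definition flat_join (K L : flat) : flat :=
  \big[flatI/flatT]_(X : flat | K :|: L \subset X) X.

Definition modular_pair (K L : flat) : bool :=
  (rk M K + rk M L == rk M (flat_join K L) + rk M (K :&: L))%N.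

(* L covers K; written K <. L in comments below *)
Definition covby (K L : flat) : bool :=
  (K \proper L) && [forall X : flat, ~~ ((K \proper X) && (X \proper L))].

Definition adj (K L : flat) : bool := covby K L || covby L K.

Definition is_flag_path (s : seq flat) : bool := (s != [::]) && sorted adj s.

Record flag_path := FlagPath
  { flag_path_seq :> seq flat; _ : is_flag_path flag_path_seq }.

HB.instance Definition _ := [isSub for flag_path_seq].
HB.instance Definition _ := [Choice of flag_path by <:].

Definition path_alg : Type := {freeg flag_path / int}.

HB.instance Definition _ := GRing.Lmodule.on path_alg.

(* The basis element of the flag path [s]. The value 0 on sequences that are
   not flag paths is only a totality convention: it is never reached below, as
   K :&: K' <. K implies K :&: K' <. K' when K and K' are covered by L. *)
Definition path_elt (s : seq flat) : path_alg :=
  if insub s is Some p then << (p : flag_path) >> else 0.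

Definition concat (p q : seq flat) : path_alg :=
  match p, q with
  | K :: p', L :: q' => if last K p' == L then path_elt (p ++ q') else 0
  | _, _ => 0
  end.

Definition path_mul (f g : path_alg) : path_alg :=
  fglift (fun p : flag_path => fglift (fun q : flag_path => concat p q) g) f.

Definition path_one : path_alg := \sum_(K : flat) path_elt [:: K].

Lemma path_eltE (p : flag_path) : path_elt p = << p >>.
Proof. by rewrite /path_elt valK. Qed.

Lemma path_elt_ind (P : path_alg -> Prop) :
    P 0 -> (forall f g, P f -> P g -> P (f + g)) ->
    (forall (c : int) (p : flag_path), P (c *: path_elt p)) ->
  forall f, P f.
Proof.
move=> P0 PD PU f; rewrite -[f]freeg_sumE.
apply: (big_ind P) => // p _.
suff -> : << coeff p f *g p >> = coeff p f *: path_elt p :> path_alg by [].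
rewrite path_eltE; apply/eqP/freeg_eqP => q; rewrite [RHS]coeffZ !coeffU.
by rewrite mul1r.
Qed.

Section Lift.
Variable h : flag_path -> path_alg.
Let l : path_alg -> path_alg := fglift h.

Lemma liftP_add : {morph l : f g / f + g}.
Proof.
have B f g : l (f - g) = l f - l g by exact: lift_is_additive.
have l0 : l 0 = 0 by have := B 0 0; rewrite !subrr.
have lN g : l (- g) = - l g by rewrite -[- g]add0r B l0 add0r.
by move=> f g; rewrite -[g in LHS]opprK B lN opprK.
Qed.

Lemma liftP0 : l 0 = 0.
Proof. by apply: (addrI (l 0)); rewrite -liftP_add !addr0. Qed.

Lemma liftP_path_elt (p : flag_path) : l (path_elt p) = h p.
Proof. by rewrite path_eltE /l liftU scale1r. Qed.

Lemma liftP_scale (c : int) f : l (c *: f) = c *: l f.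
Proof.
have lN g : l (- g) = - l g.
  by apply: (addrI (l g)); rewrite -liftP_add !subrr liftP0.
have lMn n g : l (g *+ n) = l g *+ n.
  by elim: n => [|n IHn]; rewrite ?mulr0n ?liftP0 // !mulrS liftP_add IHn.
rewrite -[c]intz !scaler_int; case: c => n; first by rewrite -!pmulrn lMn.
by rewrite NegzE !mulrNz lN -!pmulrn lMn.
Qed.
End Lift.

Lemma path_mulU (p q : flag_path) : path_mul (path_elt p) (path_elt q) = concat p q.
Proof. by rewrite /path_mul !liftP_path_elt. Qed.

Lemma path_mulDl : left_distributive path_mul +%R.
Proof. by move=> f g h; rewrite /path_mul liftP_add. Qed.

Lemma path_mulZl c f g : path_mul (c *: f) g = c *: path_mul f g.
Proof. by rewrite /path_mul liftP_scale. Qed.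

Lemma path_mul0l g : path_mul 0 g = 0.
Proof. by rewrite /path_mul liftP0. Qed.

Lemma path_mulDr : right_distributive path_mul +%R.
Proof.
move=> f g h; elim/path_elt_ind: f => [|f1 f2 IH1 IH2|c p].
- by rewrite !path_mul0l addr0.
- by rewrite !path_mulDl IH1 IH2 addrACA.
by rewrite !path_mulZl /path_mul !liftP_path_elt liftP_add scalerDr.
Qed.

Lemma path_mul0r f : path_mul f 0 = 0.
Proof. by apply: (addrI (path_mul f 0)); rewrite -path_mulDr !addr0. Qed.

Lemma path_mulZr c f g : path_mul f (c *: g) = c *: path_mul f g.
Proof.
elim/path_elt_ind: f => [|f1 f2 IH1 IH2|d p]; first by rewrite !path_mul0l scaler0.
- by rewrite !path_mulDl IH1 IH2 scalerDr.
by rewrite !path_mulZl /path_mul !liftP_path_elt liftP_scale !scalerA mulrC.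
Qed.

Lemma path_elt_mul (s t : seq flat) :
  is_flag_path s -> is_flag_path t -> path_mul (path_elt s) (path_elt t) = concat s t.
Proof. by move=> Ps Pt; rewrite -(path_mulU (FlagPath Ps) (FlagPath Pt)). Qed.

Lemma is_flag_path_cons K s : is_flag_path (K :: s) = path adj K s.
Proof. by []. Qed.

Lemma path_mulA : associative path_mul.
Proof.
move=> f g h; elim/path_elt_ind: f => [|f1 f2 IH1 IH2|c p].
- by rewrite !path_mul0l.
- by rewrite !path_mulDl IH1 IH2.
rewrite !path_mulZl; congr (_ *: _); elim/path_elt_ind: g => [|g1 g2 IH1 IH2|d q].
- by rewrite !(path_mul0l, path_mul0r).
- by rewrite !(path_mulDl, path_mulDr) IH1 IH2.
rewrite !(path_mulZl, path_mulZr); congr (_ *: _).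
elim/path_elt_ind: h => [|h1 h2 IH1 IH2|e r].
- by rewrite !path_mul0r.
- by rewrite !path_mulDr IH1 IH2.
rewrite !path_mulZr; congr (_ *: _); rewrite !path_mulU.
case: p q r => [[|K p] // Pp] [[|L q] // Pq] [[|X r] // Pr] /=.
have [eK|nK] := eqVneq (last K p) L; last first.
  rewrite path_mul0l; case: eqVneq => [eL|_]; last by rewrite path_mul0r.
  rewrite path_elt_mul // ?is_flag_path_cons ?cat_path.
    by rewrite /concat (negPf nK).
  by move: Pq Pr; rewrite !is_flag_path_cons -eL => -> ->.
have PKq : is_flag_path (K :: p ++ q).
  by move: Pp Pq; rewrite !is_flag_path_cons cat_path eK => -> ->.
rewrite (path_elt_mul PKq Pr) /= last_cat eK.
case: eqVneq => [eL|_]; last by rewrite path_mul0r.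
have PLr : is_flag_path (L :: q ++ r).
  by move: Pq Pr; rewrite !is_flag_path_cons cat_path eL => -> ->.
by rewrite (path_elt_mul Pp PLr) /= eK eqxx catA.
Qed.

Lemma path_mul1l : left_id path_one path_mul.
Proof.
elim/path_elt_ind => [|f g IH1 IH2|c p]; first by rewrite path_mul0r.
  by rewrite path_mulDr IH1 IH2.
rewrite path_mulZr; congr (_ *: _).
rewrite (big_morph (path_mul^~ (path_elt p)) (id1 := 0) (op1 := +%R));
  last 2 first.
- by move=> x y; rewrite path_mulDl.
- by rewrite path_mul0l.
case: p => [[|K p] // Pp]; rewrite (bigD1 K) //= big1 => [|L nLK].
  by rewrite addr0 path_elt_mul //= eqxx.
by rewrite path_elt_mul //= (negPf nLK).
Qed.

Lemma path_mul1r : right_id path_one path_mul.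
Proof.
elim/path_elt_ind => [|f g IH1 IH2|c p]; first by rewrite path_mul0l.
  by rewrite path_mulDl IH1 IH2.
rewrite path_mulZl; congr (_ *: _).
rewrite (big_morph (path_mul (path_elt p)) (id1 := 0) (op1 := +%R)); last 2 first.
- by move=> x y; rewrite path_mulDr.
- by rewrite path_mul0r.
case: p => [[|K p] // Pp]; rewrite (bigD1 (last K p)) //= big1 => [|L nLK].
  by rewrite addr0 path_elt_mul //= eqxx cats0.
by rewrite path_elt_mul //= eq_sym (negPf nLK).
Qed.

HB.instance Definition _ := GRing.Zmodule_isPzRing.Build path_alg
  path_mulA path_mul1l path_mul1r path_mulDl path_mulDr.

Definition wedge_rhs (K L K' : flat) : path_alg :=
  if K == K' then path_elt [:: K] *+ #|L :\: K|
  else if covby (flatI K K') K then - path_elt [:: K; flatI K K'; K']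
  else 0.

Inductive wedge_rel : path_alg -> Prop :=
| WedgeRel K L K' of covby K L & covby K' L :
    wedge_rel (path_elt [:: K; L; K'] - wedge_rhs K L K').

Definition Stilde : Type := ring_quot wedge_rel.
HB.instance Definition _ := GRing.PzRing.on Stilde.

Definition to_Stilde : path_alg -> Stilde := \pi_(ring_quot wedge_rel).
HB.instance Definition _ := GRing.isZmodMorphism.Build path_alg Stilde to_Stilde
  (@pi_ring_quot_zmod_morphism _ wedge_rel).
HB.instance Definition _ := GRing.isMonoidMorphism.Build path_alg Stilde to_Stilde
  (@pi_ring_quot_monoid_morphism _ wedge_rel).

Inductive FS_rel : Stilde -> Prop :=
| FSup (L K : flat) of L \proper K & rk M K = (rk M L + 2)%N :
    FS_rel (\sum_(X | covby L X && covby X K) to_Stilde (path_elt [:: L; X; K]))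
| FSdown (L K : flat) of L \proper K & rk M K = (rk M L + 2)%N :
    FS_rel (\sum_(X | covby L X && covby X K) to_Stilde (path_elt [:: K; X; L])).

Definition Salg : Type := ring_quot FS_rel.
HB.instance Definition _ := GRing.PzRing.on Salg.

Definition to_Salg : Stilde -> Salg := \pi_(ring_quot FS_rel).
HB.instance Definition _ := GRing.isZmodMorphism.Build Stilde Salg to_Salg
  (@pi_ring_quot_zmod_morphism _ FS_rel).
HB.instance Definition _ := GRing.isMonoidMorphism.Build Stilde Salg to_Salg
  (@pi_ring_quot_monoid_morphism _ FS_rel).

End Flats.

Fixpoint destutter (T : eqType) (s : seq T) : seq T :=
  if s is x :: s' then
    if ohead s' == Some x then destutter s' else x :: destutter s'
  else [::].

Section DoubleCosets.
Variables k l n : nat.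

(* The subgroup S_k of S_n; [i : 'I_n] stands for the point i + 1 of {1..n}. *)
Definition Sym_first (m : nat) : {set 'S_n} := Sym [set i : 'I_n | (i < m)%N].

(* Products of permutations compose from left to right: [u * w * v] maps i to
   v (w (u i)), so u in S_k permutes the arguments and v in S_l the values. *)
Definition is_double_coset (C : {set 'S_n}) : Prop :=
  exists w : 'S_n, C = (Sym_first k * [set w] * Sym_first l)%g.

(* s : {k+1..n} -> {l..n}; the else-branch is the case s i = l. *)
Definition double_coset_of (s : nat -> nat) : {set 'S_n} :=
  [set w : 'S_n | [forall i : 'I_n, (k < i.+1)%N ==>
     (if (l < s i.+1)%N then (w i).+1 == s i.+1 else ((w i).+1 <= l)%N)]].

Definition perm_length (w : 'S_n) : nat :=
  #|[set ij : 'I_n * 'I_n | (ij.1 < ij.2)%N && (w ij.2 < w ij.1)%N]|.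

Definition is_min_rep (C : {set 'S_n}) (w : 'S_n) : Prop :=
  w \in C /\ forall v, v \in C -> (perm_length w <= perm_length v)%N.

End DoubleCosets.

(* Flags are indexed by rank; only the entries K k .. K n and L l .. L n are
   meaningful. *)
Section FlagPair.
Variables (E : finType) (M : matroid E) (k l n : nat) (K L : nat -> flat M).

Definition flag_pair_seq : seq (flat M) :=
  [seq K i | i <- index_iota k n.+1] ++ [seq L j | j <- rev (index_iota l n)].

Lemma flag_pair_is_path :
    (k <= n)%N -> (l <= n)%N -> K n = L n ->
    (forall i, (k <= i < n)%N -> covby (K i) (K i.+1)) ->
    (forall j, (l <= j < n)%N -> covby (L j) (L j.+1)) ->
  is_flag_path flag_pair_seq.
Proof.
have up f a m : (forall i, (a <= i < a + m)%N -> covby (f i) (f i.+1)) ->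
    path (@adj E M) (f a) [seq f i | i <- iota a.+1 m] /\
    last (f a) [seq f i | i <- iota a.+1 m] = f (a + m)%N.
  elim: m a => [|m IHm] a cf /=; first by rewrite addn0.
  have [|-> ->] := IHm a.+1.
    by move=> i /andP[ai im]; rewrite cf // ltnW // addnS.
  by rewrite /adj cf ?addSnnS // leqnn addnS ltnS leq_addr.
have down f a m : (forall i, (a <= i < a + m)%N -> covby (f i) (f i.+1)) ->
    path (@adj E M) (f (a + m)%N) [seq f i | i <- rev (iota a m)].
  elim: m => // m IHm cf; rewrite -[in iota _ _]addn1 iotaD rev_cat /=.
  rewrite /adj addnS cf ?leq_addr ?addnS ?ltnS ?leqnn // orbT /=.
  by apply: IHm => i /andP[ai im]; rewrite cf // ai addnS ltnS ltnW.
move=> le_kn le_ln eqKL covK covL.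
rewrite /is_flag_path /flag_pair_seq /index_iota subSn //= cat_path.
have [|-> ->] := up K k (n - k)%N; first by rewrite subnKC.
by rewrite subnKC // eqKL -{1}(subnKC le_ln) down // subnKC.
Qed.

Definition Dblock (i : nat) : {set E} := K i :\: K i.-1.

Definition Eblock (j : nat) : {set E} :=
  if j == l then L l : {set E} else L j :\: L j.-1.

(* The least j in {l..n} such that D_i meets E_j (n + 1 if there is none). *)
Definition sigmaKL (i : nat) : nat :=
  find [pred j | (l <= j)%N && (Dblock i :&: Eblock j != set0)] (iota 0 n.+1).

Definition corner_seq : seq (flat M) :=
  destutter (K k :: [seq flatI (K k) (L j) | j <- rev (index_iota l n)]
    ++ [seq flatI (K i) (L l) | i <- index_iota k.+1 n] ++ [:: L l]).

End FlagPair.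

(* Main.v *)
Require Import Defs.
From HB Require Import structures.
From mathcomp Require Import all_boot all_order all_algebra all_fingroup.
From mathcomp Require Import boolp zify.

(* Put G i j := K_i :&: L_j. The given flag path and F are the two extreme
   monotone lattice paths, through (n, n) and through (k, l), from (k, n) to
   (n, l) in this grid, and relation (/\) pushes a path across one unit square:
   the corner A <. T .> B with A = G i (j+1), B = G (i+1) j, T = G (i+1) (j+1)
   is replaced by A .> A :&: B <. B up to a factor 1 (a side is degenerate), -1,
   or #|T :\: A| (when A = B), or the path vanishes. The path survives all the
   squares iff every horizontal step G i j, G (i+1) j is an equality or a cover,
   and by rank counting iff all pairs (K_i, L_j) are modular. In that case
   sigma (i+1) <= j iff G i j <> G (i+1) j, so that A = B at (i, j) exactly when
   sigma (i+1) = j+1, and the squares contributing -1 correspond to the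
   inversions of w which no element of the double coset of w can avoid. *)

Set Implicit Arguments.
Unset Strict Implicit.
Unset Printing Implicit Defensive.

Import GRing.Theory Num.Theory.
Local Open Scope ring_scope.

(** * Rank and covering of flats *)

Section MatroidRank.
Variables (E : finType) (M : matroid E).
Implicit Types (A : {set E}) (X Y Z : flat M).
Local Notation rk := (rk M).

Lemma flat_rk_lt X A x : x \in A -> x \notin X -> X \subset A -> (rk X < rk A)%N.
Proof.
move=> xA xX sXA; have /forallP/(_ x)/implyP/(_ xX) := valP X.
by move=> /leq_trans; apply; apply: rk_mono; rewrite subUset sub1set xA.
Qed.

Lemma flat_proper_rk X Y : X \proper Y -> (rk X < rk Y)%N.
Proof. by case/properP=> sXY [x xY xX]; apply: flat_rk_lt xY xX sXY. Qed.

Lemma flat_le_rk X Y : X \subset Y -> (rk Y <= rk X)%N -> X = Y.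
Proof.
move=> sXY; rewrite leqNgt => rYX; apply/val_inj/eqP; rewrite /= eqEproper sXY.
by apply: contra rYX; exact: flat_proper_rk.
Qed.

(** A set of largest cardinality among those containing [A] with the rank of [A] is closed, since
    every new point raises the rank. *)
Lemma flat_span A : exists2 Z : flat M, A \subset Z & rk Z = rk A.
Proof.
pose P (B : {set E}) := (A \subset B) && (rk B == rk A).
have PA : P A by rewrite /P subxx eqxx.
case: (arg_maxnP (fun B : {set E} => #|B|) PA) => Z /andP[sAZ /eqP rZ] Zmax.
suff fZ : is_flat M Z by exists (Flat fZ).
apply/forallP => x; apply/implyP => xZ; rewrite ltn_neqAle.
rewrite rk_mono ?subsetUr // andbT; apply/negP => /eqP rxZ.
have /Zmax : P (x |: Z).
  by rewrite /P -rxZ rZ eqxx andbT (subset_trans sAZ) ?subsetUr.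
by rewrite /= cardsU1 xZ add1n => /(leq_trans (ltnSn _)); rewrite ltnn.
Qed.

Lemma rk_setU1 x A : (rk (x |: A) <= (rk A).+1)%N.
Proof.
have := rk_submod M [set x] A; have := rk_le_card M [set x]; rewrite cards1.
lia.
Qed.

Lemma covby_sub X Y : covby X Y -> X \subset Y.
Proof. by case/andP=> /proper_sub. Qed.

(** For [x] in [Y] outside [X], the flat [Z] spanned by [x |: X] has rank at most [(rk X).+1]. As
    [Z :&: Y] lies strictly above [X], the cover forces [Y \subset Z]. *)
Lemma covby_rk X Y : covby X Y -> rk Y = (rk X).+1.
Proof.
case/andP=> pXY /forallP noZ; apply/eqP.
rewrite eqn_leq (flat_proper_rk pXY) andbT.
have [sXY [x xY xX]] := properP pXY.
have [Z sZ rZ] := flat_span (x |: X).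
have := noZ (flatI Z Y); rewrite negb_and properE /=.
have -> /= : X \subset Z :&: Y.
  by rewrite subsetI sXY (subset_trans _ sZ) ?subsetUr.
have -> /= : ~~ (Z :&: Y \subset X).
  apply/subsetPn; exists x => //; rewrite inE xY andbT.
  by rewrite (subsetP sZ) ?setU11.
rewrite properE subsetIr negbK /= => sYZ.
apply: leq_trans (rk_setU1 x X); rewrite -rZ; apply: rk_mono.
by apply: subset_trans sYZ _; rewrite subsetIl.
Qed.

Lemma covby_rkP X Y : reflect (X \subset Y /\ rk Y = (rk X).+1) (covby X Y).
Proof.
apply: (iffP idP) => [cXY|[sXY rXY]].
  by rewrite covby_sub ?(covby_rk cXY).
have pXY : X \proper Y.
  by rewrite properE sXY; apply/negP => /(rk_mono M); rewrite rXY ltnn.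
rewrite /covby pXY; apply/forallP => Z; apply/negP.
by case/andP=> /flat_proper_rk ? /flat_proper_rk; lia.
Qed.

Lemma covby_neq X Y : covby X Y -> X != Y.
Proof. by move/covby_rk => r; apply/eqP => e; move: r; rewrite e => /n_Sn. Qed.

Lemma covby_sub_eq X Y Z : covby X Z -> X \subset Y -> Y \subset Z -> Y != Z -> X = Y.
Proof.
move=> /covby_rk rXZ sXY sYZ nYZ; apply: flat_le_rk => //.
by rewrite leqNgt; apply: contra nYZ => lt; apply/eqP/flat_le_rk => //; lia.
Qed.

Lemma flatI_sub X Y : X \subset Y -> flatI X Y = X.
Proof. by move=> sXY; apply/val_inj/setIidPl. Qed.

Lemma flatIC X Y : flatI X Y = flatI Y X.
Proof. by apply: val_inj; rewrite /= setIC. Qed.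

(** Sides of grid squares may degenerate; weak covers treat equalities and covers alike. *)
Definition wcovby X Y := (X == Y) || covby X Y.

Lemma wcovby_sub X Y : wcovby X Y -> X \subset Y.
Proof. by case/orP=> [/eqP->|/covby_sub]. Qed.

Lemma wcovby_rkP X Y : reflect (X \subset Y /\ (rk Y <= (rk X).+1)%N) (wcovby X Y).
Proof.
apply: (iffP orP) => [[/eqP->|/covby_rkP[-> ->]]//|[sXY rXY]].
have [-> | nXY] := eqVneq X Y; first by left.
right; apply/covby_rkP; split=> //; apply/eqP; rewrite eqn_leq rXY.
by rewrite flat_proper_rk // properEneq sXY andbT; apply: contra nXY.
Qed.

(** Apart from degenerate cases, [X] and [Y] both have rank one less than [Z], so the condition on
    the meet is symmetric in them. *)
Lemma wcovbyI X Y Z : wcovby X Z -> wcovby Y Z -> wcovby (flatI X Y) Y ->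
  wcovby (flatI X Y) X.
Proof.
have [-> _ wY _ | nXZ] := eqVneq X Z; first by rewrite flatIC flatI_sub ?wcovby_sub.
have [-> wX _ _ | nYZ] := eqVneq Y Z.
  by rewrite flatI_sub ?wcovby_sub // /wcovby eqxx.
rewrite /wcovby (negPf nXZ) (negPf nYZ) /= => /covby_rk rX /covby_rk rY.
by move=> /wcovby_rkP[_ rI]; apply/wcovby_rkP; split; [exact: subsetIl | lia].
Qed.

(** The join lies between the union and the flat spanned by the union, and these have equal rank. *)
Lemma flat_join_rk X Y : rk (flat_join X Y) = rk (X :|: Y).
Proof.
have sub (Z : flat M) : X :|: Y \subset Z -> flat_join X Y \subset Z.
  move=> sZ; rewrite /flat_join; have := mem_index_enum Z.
  elim: (index_enum _) => // V r IH; rewrite inE big_cons.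
  case/orP=> [/eqP<-|/IH sub]; first by rewrite sZ subsetIl.
  by case: ifP => // _; apply: subset_trans sub; exact: subsetIr.
apply/eqP; rewrite eqn_leq; apply/andP; split.
  by have [Z sZ <-] := flat_span (X :|: Y); apply/rk_mono/sub.
apply: rk_mono; rewrite /flat_join.
apply: (big_ind (fun Z : flat M => X :|: Y \subset Z)) => //.
- exact: subsetT.
- by move=> U V /= sU sV; rewrite subsetI sU.
Qed.

Lemma modular_pairE X Y :
  modular_pair X Y = (rk X + rk Y == rk (X :|: Y) + rk (X :&: Y))%N.
Proof. by rewrite /modular_pair flat_join_rk. Qed.

End MatroidRank.

(** * Products of edges in the algebra of flag paths *)

Lemma index_iota_rcons a b : (a <= b)%N ->
  index_iota a b.+1 = rcons (index_iota a b) b.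
Proof.
by move=> ab; rewrite /index_iota subSn // -[(b - a).+1]addn1 iotaD cats1 subnKC.
Qed.

(** * Monotone runs of an indexed sequence *)

Section MonotoneWalks.
Variables (T : Type) (e : rel T) (f : nat -> T).

Lemma last_up a b : (a <= b)%N ->
  last (f a) [seq f i | i <- index_iota a.+1 b.+1] = f b.
Proof.
case: b => [|b]; first by rewrite leqn0 => /eqP->.
rewrite leq_eqVlt => /orP[/eqP->|lab]; first by rewrite /index_iota subnn.
by rewrite index_iota_rcons // map_rcons last_rcons.
Qed.

Lemma path_up a b : (a <= b)%N -> (forall i, (a <= i < b)%N -> e (f i) (f i.+1)) ->
  path e (f a) [seq f i | i <- index_iota a.+1 b.+1].
Proof.
elim: b => [|b IH]; first by rewrite leqn0 => /eqP->.
rewrite leq_eqVlt => /orP[/eqP->|lab ef]; first by rewrite /index_iota subnn.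
rewrite index_iota_rcons // map_rcons rcons_path last_up //.
rewrite IH ?ef //= => [|i ai]; last by apply: ef; lia.
by rewrite ltnSn andbT.
Qed.

Lemma last_down a b : (a <= b)%N ->
  last (f b) [seq f j | j <- rev (index_iota a b)] = f a.
Proof.
elim: b => [|b IH]; first by rewrite leqn0 => /eqP->.
rewrite leq_eqVlt => /orP[/eqP->|lab]; first by rewrite /index_iota subnn.
by rewrite index_iota_rcons // rev_rcons /= IH.
Qed.

Lemma path_down a b : (a <= b)%N -> (forall j, (a <= j < b)%N -> e (f j.+1) (f j)) ->
  path e (f b) [seq f j | j <- rev (index_iota a b)].
Proof.
elim: b => [|b IH]; first by rewrite leqn0 => /eqP->.
rewrite leq_eqVlt => /orP[/eqP->|lab ef]; first by rewrite /index_iota subnn.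
rewrite index_iota_rcons // rev_rcons /= ef ?ltnSn ?andbT //=.
by apply: IH => // i ai; apply: ef; lia.
Qed.

End MonotoneWalks.

Section EdgeProducts.
Variables (E : finType) (M : matroid E).
Implicit Types (X Y A B T : flat M) (s : seq (flat M)).
Local Notation pi := (@to_Stilde E M).

(** A degenerate edge is the idempotent of its vertex, so a walk with repetitions is still a product
    of edges. *)
Definition edge X Y : Stilde M := pi (path_elt (if X == Y then [:: X] else [:: X; Y])).

(** The empty product is the unit of the algebra, not the idempotent at [X]; hence the leading
    factor [edge X X] in later formulas. *)
Fixpoint edges X s : Stilde M :=
  if s is Y :: s' then edge X Y * edges Y s' else 1.

Lemma path_elt0 s : ~~ is_flag_path s -> path_elt s = 0.
Proof. by move=> Ns; rewrite /path_elt insubF //; apply: negbTE. Qed.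

Lemma path_elt_cat X s Y t : is_flag_path (X :: s) -> is_flag_path (Y :: t) ->
  last X s = Y ->
  pi (path_elt (X :: s)) * pi (path_elt (Y :: t)) = pi (path_elt (X :: s ++ t)).
Proof.
move=> Ps Pt e; rewrite -rmorphM; congr (pi _).
by rewrite [LHS](path_elt_mul Ps Pt) /concat e eqxx.
Qed.

Lemma edgexx X : edge X X = pi (path_elt [:: X]).
Proof. by rewrite /edge eqxx. Qed.

Lemma adj_neq X Y : adj X Y -> X != Y.
Proof. by case/orP=> /covby_neq //; rewrite eq_sym. Qed.

Lemma edge_adj X Y : adj X Y -> edge X Y = pi (path_elt [:: X; Y]).
Proof. by move/adj_neq/negbTE; rewrite /edge => ->. Qed.

Lemma edge_idl X Y : edge X X * edge X Y = edge X Y.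
Proof.
rewrite edgexx /edge; have [_ | nXY] := eqVneq X Y; first exact: path_elt_cat.
have [aXY | naXY] := boolP (adj X Y); first by rewrite path_elt_cat //= /is_flag_path /= aXY.
by rewrite [path_elt [:: X; Y]]path_elt0 ?rmorph0 ?mulr0 // /is_flag_path /= andbT.
Qed.

Lemma edge_idr X Y : edge X Y * edge Y Y = edge X Y.
Proof.
rewrite edgexx /edge; have [-> | nXY] := eqVneq X Y; first exact: path_elt_cat.
have [aXY | naXY] := boolP (adj X Y); first by rewrite path_elt_cat //= /is_flag_path /= aXY.
by rewrite [path_elt [:: X; Y]]path_elt0 ?rmorph0 ?mul0r // /is_flag_path /= andbT.
Qed.

Lemma edges_cat X s t : edges X (s ++ t) = edges X s * edges (last X s) t.
Proof. by elim: s X => [|Y s IH] X /=; rewrite ?mul1r // IH mulrA. Qed.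

Lemma edges_idr X s : edge X X * edges X s * edge (last X s) (last X s) = edge X X * edges X s.
Proof.
elim: s X => [|Y s IH] X /=; first by rewrite mulr1 edge_idr.
by rewrite -[edge X Y]edge_idr -!mulrA [edge Y Y * _]mulrA IH.
Qed.

(** * Removing repetitions from a walk *)

Definition wadj X Y := (X == Y) || adj X Y.

Lemma head_destutter X s : {t | destutter (X :: s) = X :: t}.
Proof.
elim: s X => [|Y s IH] X; first by exists [::].
rewrite /=; case: eqP => [[<-]|_]; first exact: IH.
by exists (destutter (Y :: s)).
Qed.

Lemma destutter_path X s : path wadj X s -> is_flag_path (destutter (X :: s)).
Proof.
elim: s X => [|Y s IH] X //= /andP[wXY /IH Ps].
case: eqP => [//|nYX]; rewrite /= in Ps *; move: Ps.
have [t /= ->] := head_destutter Y s; rewrite /is_flag_path /= => ->; rewrite andbT.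
by case/orP: wXY => // /eqP eXY; case: nYX; rewrite eXY.
Qed.

(** Dropping a repeated vertex amounts to absorbing its idempotent, so [F] can be evaluated with its
    repetitions kept. *)
Lemma path_elt_destutter X s : path wadj X s ->
  pi (path_elt (destutter (X :: s))) = edge X X * edges X s.
Proof.
elim: s X => [|Y s IH] X; first by rewrite /= mulr1 edgexx.
move=> /[dup] Ps /= /andP[wXY Ps']; have := IH Y Ps'; have := destutter_path Ps.
rewrite /=; case: eqP => [[->] _ -> | nYX].
  by rewrite mulrA edge_idl.
have [t /= ->] := head_destutter Y s => /andP[_ /= /andP[aXY PYt]] Et.
rewrite mulrA edge_idl -edge_idr -mulrA -Et edge_adj //.
by rewrite path_elt_cat // /is_flag_path /= aXY.
Qed.

Lemma destutter_id X s : path (@adj E M) X s -> destutter (X :: s) = X :: s.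
Proof.
elim: s X => [|Y s IH] X //= /andP[aXY Ps].
case: eqP => [[eXY]|_]; last by congr (_ :: _); exact: IH.
by have := adj_neq aXY; rewrite eXY eqxx.
Qed.

Lemma path_elt_edges X s : path (@adj E M) X s ->
  pi (path_elt (X :: s)) = edge X X * edges X s.
Proof.
move=> Ps; rewrite -path_elt_destutter ?destutter_id //.
by apply: sub_path Ps => Y Z; rewrite /wadj orbC => ->.
Qed.

Lemma edges_up (f : nat -> flat M) a b : (a <= b)%N ->
  edges (f a) [seq f i | i <- index_iota a.+1 b.+1] =
  \prod_(a <= i < b) edge (f i) (f i.+1).
Proof.
elim: b => [|b IH]; first by rewrite leqn0 => /eqP->; rewrite big_geq.
rewrite leq_eqVlt => /orP[/eqP->|lab]; first by rewrite big_geq // /index_iota subnn.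
rewrite index_iota_rcons // map_rcons -cats1 edges_cat IH // last_up //=.
by rewrite mulr1 [RHS]big_nat_recr.
Qed.

Lemma edges_down (f : nat -> flat M) a b : (a <= b)%N ->
  edges (f b) [seq f j | j <- rev (index_iota a b)] =
  \prod_(j <- rev (index_iota a b)) edge (f j.+1) (f j).
Proof.
elim: b => [|b IH]; first by rewrite leqn0 => /eqP->; rewrite big_nil.
rewrite leq_eqVlt => /orP[/eqP->|lab].
  by rewrite /index_iota subnn big_nil.
by rewrite index_iota_rcons // rev_rcons big_cons -IH.
Qed.

(** * Pushing a walk across a unit square *)

Definition corner_coef A B T : int :=
  if (A != T) && (B != T) then if A == B then #|T :\: A|%N%:Z else -1 else 1.

Lemma wedge A B T : covby A T -> covby B T ->
  pi (path_elt [:: A; T; B]) = pi (wedge_rhs A T B).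
Proof.
move=> cA cB; apply/ring_quotP/asboolP; apply: gen_ideal_in; exact: WedgeRel.
Qed.

Lemma edge_corner A B T : covby A T -> covby B T ->
  edge A T * edge T B = pi (wedge_rhs A T B).
Proof.
move=> cA cB; have aA : adj A T by rewrite /adj cA.
have aB : adj T B by rewrite /adj cB orbT.
by rewrite -wedge // !edge_adj // path_elt_cat // /is_flag_path /= ?aA ?aB.
Qed.

(** If a side is degenerate, both products reduce to [edge A B]; if [A = B], the lower walk is the
    idempotent at [A]; otherwise both steps at the meet are covers and the relation gives -1. *)
Lemma edge_square A B T : wcovby A T -> wcovby B T -> wcovby (flatI A B) B ->
  edge A T * edge T B =
  (edge A (flatI A B) * edge (flatI A B) B) *~ corner_coef A B T.
Proof.
move=> wA wB wI; have wI' := wcovbyI wA wB wI.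
rewrite /corner_coef; have [eA | nA] /= := eqVneq A T.
  by rewrite -{}eA in wB *; rewrite [flatI A B]flatIC flatI_sub ?wcovby_sub // edge_idl edge_idr.
have [eB | nB] /= := eqVneq B T.
  by rewrite -{}eB in wA *; rewrite flatI_sub ?wcovby_sub // edge_idl edge_idr.
have cA : covby A T by move: wA; rewrite /wcovby (negPf nA).
have cB : covby B T by move: wB; rewrite /wcovby (negPf nB).
rewrite edge_corner // /wedge_rhs; have [<- | nAB] := eqVneq A B.
  by rewrite flatI_sub // edge_idl edgexx rmorphMn.
have nIA : flatI A B != A.
  apply: contra nAB => /eqP/(congr1 val)/setIidPl sAB.
  by apply/eqP/(covby_sub_eq cA) => //; exact: wcovby_sub.
have nIB : flatI A B != B.
  apply: contra nAB => /eqP/(congr1 val)/setIidPr sBA.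
  by rewrite eq_sym; apply/eqP/(covby_sub_eq cB) => //; exact: wcovby_sub.
have cI : covby (flatI A B) A by move: wI'; rewrite /wcovby (negPf nIA).
have cI' : covby (flatI A B) B by move: wI; rewrite /wcovby (negPf nIB).
rewrite cI rmorphN mulrN1z !edge_adj /adj ?cI ?cI' ?orbT //.
by rewrite path_elt_cat // /is_flag_path /= /adj ?cI ?cI' ?orbT.
Qed.

(** The failing weak cover excludes degenerate sides and [A = B]. By the symmetry in [wcovbyI] the
    meet is not covered by [A] either, which is the vanishing case of the relation. *)
Lemma edge_square0 A B T : wcovby A T -> wcovby B T -> ~~ wcovby (flatI A B) B ->
  edge A T * edge T B = 0.
Proof.
move=> wA wB; have [-> | nA] := eqVneq A T.
  by rewrite flatIC flatI_sub ?wcovby_sub // /wcovby eqxx.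
have [-> | nB] := eqVneq B T.
  by rewrite flatI_sub ?wcovby_sub // wA.
have cA : covby A T by move: wA; rewrite /wcovby (negPf nA).
have cB : covby B T by move: wB; rewrite /wcovby (negPf nB).
rewrite edge_corner // /wedge_rhs; have [<- | nAB] := eqVneq A B.
  by rewrite flatI_sub // /wcovby eqxx.
case: ifP; last by rewrite rmorph0.
move=> cI; rewrite flatIC [flatI B A]flatIC => /negP[]; rewrite flatIC.
by apply: wcovbyI wB wA _; rewrite flatIC /wcovby cI orbT.
Qed.

End EdgeProducts.

(** * Sweeping the grid of intersections *)

Lemma down_ind (a n : nat) (P : nat -> Prop) : P n ->
  (forall m, (a <= m < n)%N -> P m.+1 -> P m) ->
  forall m, (a <= m <= n)%N -> P m.
Proof.
move=> Pn IH m /andP[am mn]; rewrite -(subKn mn).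
elim: (n - m)%N (leq_sub2l n am) => [|d IHd] ld; first by rewrite subn0.
have [nd | dn] := leqP n d.
  by move: (IHd (ltnW ld)); rewrite (eqP nd) (eqP (leqW nd)).
by apply: IH; [lia | rewrite subnSK //; apply: IHd; exact: ltnW].
Qed.

Section Grid.
Variables (E : finType) (M : matroid E) (k l n : nat) (K L : nat -> flat M).
Hypothesis (le_kn : (k <= n)%N) (le_ln : (l <= n)%N).
Hypothesis (covK : forall i, (k <= i < n)%N -> covby (K i) (K i.+1)).
Hypothesis (covL : forall j, (l <= j < n)%N -> covby (L j) (L j.+1)).
Hypothesis (eqKL : K n = L n).

Definition grid i j : flat M := flatI (K i) (L j).

Let subK i : (k <= i < n)%N -> K i \subset K i.+1.
Proof. by move/covK/covby_sub. Qed.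

Let subL j : (l <= j < n)%N -> L j \subset L j.+1.
Proof. by move/covL/covby_sub. Qed.

Lemma grid_Kn i : (k <= i <= n)%N -> grid i n = K i.
Proof.
move=> ki; apply: flatI_sub; rewrite -eqKL; move: i ki; apply: down_ind => //.
by move=> i /subK; exact: subset_trans.
Qed.

Lemma grid_nL j : (l <= j <= n)%N -> grid n j = L j.
Proof.
move=> lj; rewrite /grid flatIC; apply: flatI_sub; rewrite eqKL; move: j lj.
by apply: down_ind => // j /subL; exact: subset_trans.
Qed.

Lemma grid_meet i j : (k <= i < n)%N -> (l <= j < n)%N ->
  flatI (grid i j.+1) (grid i.+1 j) = grid i j.
Proof.
move=> /subK/setIidPl sK /subL/setIidPl sL; apply: val_inj => /=.
by rewrite setIACA sK [L j.+1 :&: _]setIC sL.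
Qed.

Lemma grid_subl i j : (k <= i < n)%N -> grid i j \subset grid i.+1 j.
Proof. by move=> ki; apply: setSI; exact: subK. Qed.

Lemma grid_subr i j : (l <= j < n)%N -> grid i j \subset grid i j.+1.
Proof. by move=> lj; apply: setIS; exact: subL. Qed.

(** [hgood i] ensures that no square between the columns [i] and [i.+1] kills the path. [vgood] then
    spreads leftwards from column [n], where it holds because the [L j] form a flag. *)
Definition hgood i := forall j, (l <= j <= n)%N -> wcovby (grid i j) (grid i.+1 j).
Definition vgood i := forall j, (l <= j < n)%N -> wcovby (grid i j) (grid i j.+1).

Definition square_coef i j :=
  corner_coef (grid i j.+1) (grid i.+1 j) (grid i.+1 j.+1).
Definition descent i m : Stilde M :=
  \prod_(j <- rev (index_iota m n)) edge (grid i j.+1) (grid i j).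

Lemma descent_rec i m : (m < n)%N ->
  descent i m = descent i m.+1 * edge (grid i m.+1) (grid i m).
Proof.
by move=> mn; rewrite /descent [in LHS]/index_iota -(subnSK mn) /= rev_cons big_rcons.
Qed.

Lemma descent_nn i : descent i n = 1.
Proof. by rewrite /descent /index_iota subnn big_nil. Qed.

Lemma vgood_n : vgood n.
Proof.
move=> j /[dup] lj /covL cL; rewrite /wcovby !grid_nL ?cL ?orbT //; lia.
Qed.

Lemma hgood_n i : (k <= i < n)%N -> wcovby (grid i n) (grid i.+1 n).
Proof.
move=> /[dup] ki /covK cK; rewrite /wcovby !grid_Kn ?cK ?orbT //; lia.
Qed.

Lemma vgoodP i : (k <= i < n)%N -> vgood i.+1 -> hgood i -> vgood i.
Proof.
move=> ki vg hg j lj; rewrite -(grid_meet ki lj).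
apply: wcovbyI (vg j lj) _; first by apply: hg; lia.
by rewrite grid_meet //; apply: hg; lia.
Qed.

(** Each unit square moves the horizontal edge down by one level. Only the levels from [m] on are
    constrained, so that [column_sweep0] can sweep as far as the first failure. *)
Lemma column_sweep i m : (k <= i < n)%N -> vgood i.+1 -> (l <= m <= n)%N ->
  (forall j, (m <= j <= n)%N -> wcovby (grid i j) (grid i.+1 j)) ->
  edge (grid i n) (grid i.+1 n) * descent i.+1 m =
  (descent i m * edge (grid i m) (grid i.+1 m)) *~ \prod_(m <= j < n) square_coef i j.
Proof.
move=> ki vg; move: m; apply: down_ind => [_|m lm IH hg].
  by rewrite !descent_nn big_geq // mulr1 mul1r.
have mn : (m < n)%N by case/andP: lm.
rewrite [descent i.+1 m]descent_rec // mulrA IH => [|j mj]; last by apply: hg; lia.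
rewrite mulrzAl -mulrA edge_square ?grid_meet //; last 3 first.
- by apply: hg; lia.
- exact: vg.
- by apply: hg; lia.
rewrite mulrzAr -mulrzA mulrA -descent_rec // [in RHS]big_ltn //.
Qed.

(** At the highest level where the horizontal step is not a weak cover the square vanishes, and
    descending further keeps the product 0. *)
Lemma column_sweep0 i m : (k <= i < n)%N -> vgood i.+1 -> (l <= m <= n)%N ->
  (forall j, (m <= j <= n)%N -> wcovby (grid i j) (grid i.+1 j)) \/
  edge (grid i n) (grid i.+1 n) * descent i.+1 m = 0.
Proof.
move=> ki vg; move: m; apply: down_ind => [|m lm [hg | e0]].
- by left=> j; rewrite -eqn_leq => /eqP<-; exact: hgood_n.
- have mn : (m < n)%N by case/andP: lm.
  have [wm | nwm] := boolP (wcovby (grid i m) (grid i.+1 m)).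
    left=> j /andP[]; rewrite leq_eqVlt => /orP[/eqP<- //|mj jn].
    by apply: hg; rewrite mj.
  right; rewrite descent_rec // mulrA column_sweep //; last by lia.
  rewrite mulrzAl -mulrA edge_square0 ?mulr0 ?mul0rz // ?grid_meet //; last exact: vg.
  by apply: hg; lia.
- by right; rewrite descent_rec ?mulrA ?e0 ?mul0r //; case/andP: lm.
Qed.

(** Columns are swept from right to left; [vgood m] is carried along because sweeping the next
    column requires it. *)
Lemma sweep m : (k <= m <= n)%N -> (forall i, (m <= i < n)%N -> hgood i) ->
  vgood m /\
  \prod_(m <= i < n) edge (grid i n) (grid i.+1 n) * descent n l =
  (descent m l * \prod_(m <= i < n) edge (grid i l) (grid i.+1 l))
    *~ \prod_(m <= i < n) \prod_(l <= j < n) square_coef i j.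
Proof.
move: m; apply: down_ind => [_|m km IH hg].
  by split; [exact: vgood_n | rewrite !big_geq // mul1r mulr1].
have [|vg e] := IH; first by move=> i ?; apply: hg; lia.
have hgm : hgood m by apply: hg; lia.
split; first exact: vgoodP.
have mn : (m < n)%N by case/andP: km.
rewrite !(big_ltn mn) -mulrA e mulrzAr [edge _ (grid _ n) * _]mulrA column_sweep //; last by lia.
by rewrite mulrzAl -mulrA -mulrzA.
Qed.

Lemma sweep0 m : (k <= m <= n)%N ->
  (forall i, (m <= i < n)%N -> hgood i) \/
  \prod_(m <= i < n) edge (grid i n) (grid i.+1 n) * descent n l = 0.
Proof.
move: m; apply: down_ind => [|m km [hg | e0]].
- by left=> i; lia.
- have [|vg e] := sweep _ hg; first by lia.
  have mn : (m < n)%N by case/andP: km.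
  have ll : (l <= l <= n)%N by rewrite leqnn.
  have [hgm | e0] := column_sweep0 km vg ll.
    left=> i /andP[]; rewrite leq_eqVlt => /orP[/eqP<- //|mi ni].
    by apply: hg; rewrite mi.
  by right; rewrite big_ltn // -mulrA e mulrzAr [edge _ (grid _ n) * _]mulrA e0 mul0r mul0rz.
- by right; rewrite big_ltn ?(proj2 (andP km)) // -mulrA e0 mulr0.
Qed.

Lemma path_elt_flag_pair :
  to_Stilde (path_elt (flag_pair_seq k l n K L)) =
  edge (K k) (K k) * (\prod_(k <= i < n) edge (grid i n) (grid i.+1 n) * descent n l).
Proof.
have := flag_pair_is_path le_kn le_ln eqKL covK covL.
have eK : index_iota k n.+1 = k :: index_iota k.+1 n.+1.
  by rewrite /index_iota subSn // subSS.
rewrite /flag_pair_seq eK map_cons cat_cons => /path_elt_edges ->.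
rewrite edges_cat edges_up // last_up // eqKL; congr (_ * (_ * _)).
  by apply: eq_big_nat => i ki; rewrite !grid_Kn //; lia.
rewrite edges_down // /descent [LHS]big_seq [RHS]big_seq.
apply: eq_bigr => j; rewrite mem_rev mem_index_iota => lj.
by rewrite !grid_nL //; lia.
Qed.

Lemma corner_seqP : (forall i, (k <= i < n)%N -> hgood i) ->
  is_flag_path (corner_seq k l n K L) /\
  to_Stilde (path_elt (corner_seq k l n K L)) =
  edge (K k) (K k) * (descent k l * \prod_(k <= i < n) edge (grid i l) (grid i.+1 l)).
Proof.
move=> hg; have [|vg _] := sweep _ hg; first by rewrite leqnn.
have eLl : L l = grid n l by rewrite grid_nL ?leqnn.
have eKk : K k = grid k n by rewrite grid_Kn ?leqnn.
have wdown j : (l <= j < n)%N -> wadj (grid k j.+1) (grid k j).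
  by move=> /vg /orP[/eqP->|cov]; rewrite /wadj ?eqxx // /adj cov !orbT.
have wup i : (k <= i < n)%N -> wadj (grid i l) (grid i.+1 l).
  move=> /hg/(_ l); rewrite leqnn le_ln => /(_ isT).
  by case/orP=> [/eqP->|cov]; rewrite /wadj ?eqxx // /adj cov !orbT.
pose s := [seq grid k j | j <- rev (index_iota l n)]
  ++ [seq grid i l | i <- index_iota k.+1 n] ++ [:: L l].
rewrite -[corner_seq k l n K L]/(destutter (K k :: s)).
have [Ps Es] : path (@wadj E M) (K k) s /\ edge (K k) (K k) * edges (K k) s =
  edge (K k) (K k) * (descent k l * \prod_(k <= i < n) edge (grid i l) (grid i.+1 l)).
  rewrite /s eKk eLl; move: (le_kn); rewrite leq_eqVlt => /predU1P[ekn|kn].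
    (* For [k = n] the final [L l] repeats the end of the descent, and its idempotent is
       absorbed. *)
    have -> : index_iota k.+1 n = [::] by rewrite /index_iota -ekn (eqnP (leqnSn k)).
    have -> : grid n l = grid k l by rewrite -ekn.
    rewrite cat_path edges_cat (last_down (grid k)) // path_down //= mulr1 /wadj eqxx.
    have := edges_idr (grid k n) [seq grid k j | j <- rev (index_iota l n)].
    by rewrite (last_down (grid k)) // -mulrA => ->; rewrite edges_down // big_geq ?ekn // mulr1.
  have <- : [seq grid i l | i <- index_iota k.+1 n.+1] =
    [seq grid i l | i <- index_iota k.+1 n] ++ [:: grid n l].
    by rewrite index_iota_rcons // map_rcons cats1.
  rewrite cat_path edges_cat edges_down // (last_down (grid k)) //.
  rewrite (edges_up (grid^~ l)) // path_down //.
  by rewrite (path_up (f := grid^~ l)).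
by split; [exact: destutter_path | rewrite path_elt_destutter].
Qed.

End Grid.

(** * Inversions and double cosets of permutations *)

(* The Vandermonde determinants of (0, ..., n-1) and of its rearrangement by w
   differ by sgn w, and have the same absolute value; the sign of the latter
   counts the inversions of w. *)
Lemma sign_perm_length n (w : 'S_n) : (-1) ^+ w = (-1) ^+ perm_length w :> int.
Proof.
pose a (u : 'S_n) : 'rV[int]_n := \row_j (u j)%:Z.
have detP u : \det (Vandermonde n (a u)) =
    \prod_(i < n) \prod_(j < n | (i < j)%N) ((u j)%:Z - (u i)%:Z).
  rewrite det_Vandermonde; apply: eq_bigr => i _; apply: eq_bigr => j _.
  by rewrite !mxE.
have det_w : \det (Vandermonde n (a w)) = (-1) ^+ w * \det (Vandermonde n (a 1%g)).
  have -> : Vandermonde n (a w) = col_perm w (Vandermonde n (a 1%g)).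
    by apply/matrixP => i j; rewrite !mxE perm1.
  by rewrite col_permE det_mulmx det_perm mulrC odd_permV.
have sg u : Num.sg (\det (Vandermonde n (a u))) = (-1) ^+ perm_length u.
  rewrite detP /perm_length -sum1_card expr_sum.
  rewrite (eq_bigl (fun ij : 'I_n * 'I_n => (ij.1 < ij.2)%N && (u ij.2 < u ij.1)%N));
    last by move=> ij; rewrite inE.
  rewrite big_mkcondr /= -(pair_big_dep xpredT (fun i j : 'I_n => (i < j)%N)
    (fun i j => if (u j < u i)%N then (-1) ^+ 1 else 1)) /=.
  rewrite (big_morph _ (@sgrM int) (@sgr1 int)); apply: eq_bigr => i _.
  rewrite (big_morph _ (@sgrM int) (@sgr1 int)); apply: eq_bigr => j ij.
  have : u i != u j by rewrite (inj_eq perm_inj); apply: contraTneq ij => ->; rewrite ltnn.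
  rewrite -val_eqE /= expr1; case: ltngtP => // lt _.
    by rewrite ltr0_sg // subr_lt0 ltz_nat.
  by rewrite gtr0_sg // subr_gt0 ltz_nat.
have := congr1 Num.sg det_w; rewrite sgrM !sg sgrX sgrN1 => ->.
suff -> : perm_length (1 : 'S_n)%g = 0%N by rewrite expr0 mulr1.
apply/eqP; rewrite cards_eq0 -subset0; apply/subsetP => ij.
by rewrite !inE !perm1; case: ltngtP.
Qed.

(** Extend [f] from [A :\ x] and correct the value at [x] by a transposition, which moves none of
    the values already assigned. *)
Lemma perm_extend (T : finType) (A : {set T}) (f : T -> T) :
  {in A &, injective f} -> exists w : {perm T}, {in A, w =1 f}.
Proof.
have [m] := ubnP #|A|; elim: m A => // m IH A leA injf.
have [-> | [x xA]] := set_0Vmem A; first by exists 1%g => x; rewrite inE.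
have [||w wf] := IH (A :\ x).
- by move: leA; rewrite (cardsD1 x) xA.
- by move=> y z; rewrite !inE => /andP[_ yA] /andP[_ zA]; exact: injf.
exists (w * tperm (w x) (f x))%g => y yA; rewrite permM.
have [-> | nyx] := eqVneq y x; first by rewrite tpermL.
have yA' : y \in A :\ x by rewrite !inE nyx.
rewrite -[in RHS]wf // tpermD //; first by rewrite (inj_eq perm_inj) eq_sym.
by rewrite wf //; apply: contra nyx => /eqP/injf->.
Qed.

Section DoubleCoset.
Variables (k l n : nat) (s : nat -> nat).
Local Notation C := (double_coset_of k l n s).

Lemma double_cosetP (w : 'S_n) : reflect
  (forall i : 'I_n, (k <= i)%N ->
     if (l < s i.+1)%N then (w i).+1 = s i.+1 else (w i < l)%N) (w \in C).
Proof.
rewrite inE; apply: (iffP forallP) => wC i; have := wC i; rewrite ltnS.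
  by move=> /implyP/[apply]; case: ifP => // _ /eqP.
by move=> H; apply/implyP => /H; case: ifP => // _ ->.
Qed.

Lemma Sym_firstP m (u : 'S_n) :
  reflect (forall i : 'I_n, (m <= i)%N -> u i = i) (u \in Sym_first n m).
Proof.
rewrite inE; apply: (iffP subsetP) => H i.
  by rewrite leqNgt; apply: contraNeq => /H; rewrite inE.
by rewrite !inE; apply: contraR; rewrite -leqNgt => /H/eqP.
Qed.

(** Any other element [w'] is [u * w * v]: choose [v] fixing the values from [l] on and sending
    [w i] to [w' i] for [k <= i]; then [u = w' * v^-1 * w^-1] fixes the arguments from [k] on. *)
Lemma double_coset_of_mem (w : 'S_n) : w \in C -> is_double_coset k l C.
Proof.
move=> /double_cosetP wC; exists w; apply/setP => w'; apply/idP/idP.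
  move/double_cosetP => w'C.
  pose A := [set j : 'I_n | (l <= j)%N || (k <= (w^-1)%g j)%N].
  pose f (j : 'I_n) := if (l <= j)%N then j else w' ((w^-1)%g j).
  (* [f] keeps values below [l] below [l], so its two branches cannot collide. *)
  have f_lt (j : 'I_n) : (j < l)%N -> j \in A -> (f j < l)%N.
    move=> jl; rewrite inE /f leqNgt jl /= => kj; have := w'C _ kj.
    by have := wC _ kj; rewrite permKV; case: ifP => //; lia.
  have injf : {in A &, injective f}.
    move=> i j iA jA; case: (leqP l i) => [li|il]; case: (leqP l j) => [lj|jl].
    - by rewrite /f li lj.
    - by have := f_lt _ jl jA; rewrite {2}/f li => ? e; move: li; rewrite e; lia.
    - by have := f_lt _ il iA; rewrite {3}/f lj => ? e; move: lj; rewrite -e; lia.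
    - by rewrite /f (leqNgt l i) (leqNgt l j) il jl /= => /perm_inj/perm_inj.
  have [v vf] := perm_extend injf.
  have -> : w' = ((w' * v^-1 * w^-1) * w * v)%g by rewrite !mulgKV.
  apply: mem_mulg; last first.
    by apply/Sym_firstP => j lj; rewrite vf ?inE ?lj // /f lj.
  apply: mem_mulg; last by rewrite inE.
  apply/Sym_firstP => i ki; rewrite !permM.
  apply/(canLR (permK w))/(canLR (permK v)).
  have wA : w i \in A by rewrite inE permK ki orbT.
  rewrite vf // /f permK; have := wC i ki; have := w'C i ki.
  case: ifP => [ls <- [/val_inj <-]|_ w'l wl]; last by rewrite leqNgt wl.
  by case: ifP.
case/mulsgP=> _ v /mulsgP[u _ uS /set1P-> ->] vS ->.
apply/double_cosetP => i ki; rewrite !permM (Sym_firstP _ _ uS i ki).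
have := wC i ki; case: ifP => [ls <- | _ wl].
  by rewrite (Sym_firstP _ _ vS) //; have := wC i ki; rewrite ls; lia.
rewrite ltnNge; apply: contraL wl => lv; rewrite -leqNgt.
by have /perm_inj/val_eqP := Sym_firstP _ _ vS _ lv => /eqP <-.
Qed.

(** * Minimal length in a double coset *)

Lemma double_coset_swap (w : 'S_n) (a b : 'I_n) : w \in C ->
  (a < k)%N && (b < k)%N || (w a < l)%N && (w b < l)%N -> (tperm a b * w)%g \in C.
Proof.
move=> /double_cosetP wC ab; apply/double_cosetP => i ki; rewrite permM.
have := wC i ki; case: tpermP => // e; move: ab ki; rewrite e => ab ki.
  by case: ifP => // *; lia.
by case: ifP => // *; lia.
Qed.

(** These are the inversions whose arguments are not both below [k] and whose values are not both
    below [l]. *)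
Definition outer_inv (w : 'S_n) := [set ij : 'I_n * 'I_n |
  [&& (ij.1 < ij.2)%N, (w ij.2 < w ij.1)%N, (k <= ij.2)%N & (l <= w ij.1)%N]].

Lemma leq_outer_inv (w : 'S_n) : (#|outer_inv w| <= perm_length w)%N.
Proof.
apply/subset_leq_card/subsetP => ij.
by rewrite !inE => /and4P[-> ->].
Qed.

(* Maximizing the pairing of w with the identity removes all inversions that the
   two parabolic subgroups can remove. *)
Lemma outer_inv_exact (w : 'S_n) : w \in C ->
  exists2 w0, w0 \in C & perm_length w0 = #|outer_inv w0|.
Proof.
pose m (u : 'S_n) := (\sum_(i < n) i * u i)%N.
move=> wC; case: (arg_maxnP m wC) => w0 w0C w0max; exists w0 => //.
apply: eq_card => -[a b]; rewrite !inE /=.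
case: ltnP => //= ab; case: ltnP => //= wba; apply/esym.
apply: contraT => H.
have /w0max : (tperm a b * w0)%g \in C.
  by apply: double_coset_swap => //; move: H; rewrite negb_and -!ltnNge; lia.
(* Undoing the inversion raises the sum by [(b - a) * (w0 a - w0 b)], against maximality. *)
rewrite /= leqNgt => /negP[]; rewrite /m.
have nba : b != a by apply: contraTneq ab => ->; rewrite ltnn.
rewrite (bigD1 a) // (bigD1 b) //= [X in (_ < X)%N](bigD1 a) //.
rewrite [X in (_ < _ + X)%N](bigD1 b) //= !permM tpermL tpermR.
rewrite [X in (_ < _ + (_ + X))%N](eq_bigr (fun i : 'I_n => i * w0 i)%N).
  by nia.
by move=> i /andP[ia ib]; rewrite permM tpermD // eq_sym.
Qed.

(** The number of outer inversions bounds the length from below, and some element of [C] attains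
    it. *)
Lemma min_rep_length N (w : 'S_n) :
  (forall u, u \in C -> #|outer_inv u| = N) -> is_min_rep C w -> perm_length w = N.
Proof.
move=> oN [wC wmin]; have [w0 w0C e0] := outer_inv_exact wC.
apply/eqP; rewrite eqn_leq -{1}(oN _ w0C) -e0 wmin //=.
by rewrite -(oN _ wC) leq_outer_inv.
Qed.

(** The inversion with arguments [a < b] is recorded at the cell [(b, w a)], so that inversions can
    be matched with unit squares of the grid. *)
Lemma card_outer_inv (w : 'S_n) : #|outer_inv w| =
  (\sum_(i < n | k <= i) \sum_(j < n | l <= j) ((w i < j) && ((w^-1)%g j < i)))%N.
Proof.
rewrite pair_big_dep /= -sum1_card big_mkcond [RHS]big_mkcond /=.
have bij : bijective (fun ij : 'I_n * 'I_n => ((w^-1)%g ij.2, ij.1)).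
  by exists (fun ij : 'I_n * 'I_n => (ij.2, w ij.1)) => -[i j] /=; rewrite ?permK ?permKV.
rewrite (reindex _ (onW_bij _ bij)); apply: eq_bigr => -[i j] _.
rewrite inE /= permKV; case: (k <= i)%N; case: (l <= j)%N;
  by rewrite ?andbT ?andbF //= andbC; case: (_ && _).
Qed.

End DoubleCoset.

(** * Modularity and the double coset of a pair of flags *)

Lemma covby_chain (E : finType) (M : matroid E) (f : nat -> flat M) a b :
  (forall i, (a <= i < b)%N -> covby (f i) (f i.+1)) ->
  forall i j, (a <= i)%N -> (i <= j <= b)%N -> f i \subset f j.
Proof.
move=> cov i j ai; elim: j => [|j IH] /andP[]; first by rewrite leqn0 => /eqP->.
rewrite leq_eqVlt => /orP[/eqP<- //|ij jb].
by apply: subset_trans (covby_sub (cov _ _)); [apply: IH|]; lia.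
Qed.

Section Modular.
Variables (E : finType) (M : matroid E) (k l n : nat) (K L : nat -> flat M).
Hypothesis (le_kn : (k <= n)%N) (le_ln : (l <= n)%N).
Hypothesis (covK : forall i, (k <= i < n)%N -> covby (K i) (K i.+1)).
Hypothesis (covL : forall j, (l <= j < n)%N -> covby (L j) (L j.+1)).
Hypothesis (eqKL : K n = L n).
Hypothesis (rkK : forall i, (k <= i <= n)%N -> rk M (K i) = i).
Hypothesis (rkL : forall j, (l <= j <= n)%N -> rk M (L j) = j).

Local Notation G := (grid K L).
Local Notation hgood := (hgood l n K L).
Local Notation vgood := (vgood l n K L).
Local Notation sigma := (sigmaKL l n K L).

(** * Modular pairs and ranks in the grid *)

Lemma grid_proper i j : (k <= i < n)%N -> G i j != G i.+1 j ->
  G i j \proper G i.+1 j.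
Proof. by move=> ki nG; rewrite properEneq (grid_subl L covK) // andbT. Qed.

(** Submodularity for [K i.+1] and [K i :|: L j]: their intersection contains [K i], and if the grid
    step is strict also a point outside [K i], so its rank exceeds [i]. *)
Lemma rk_union_step i j : (k <= i < n)%N ->
  (rk M (K i.+1 :|: L j) + (G i j != G i.+1 j) <= (rk M (K i :|: L j)).+1)%N.
Proof.
move=> ki; have sK : K i \subset K i.+1 by apply/covby_sub/covK.
have rKi : rk M (K i) = i by apply: rkK; lia.
have rKi1 : rk M (K i.+1) = i.+1 by apply: rkK; lia.
have := rk_submod M (K i.+1) (K i :|: L j).
have -> : K i.+1 :|: (K i :|: L j) = K i.+1 :|: L j by rewrite setUA (setUidPl sK).
have sI : K i \subset K i.+1 :&: (K i :|: L j) by rewrite subsetI sK subsetUl.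
have [_ | nG] := eqVneq; first by have := rk_mono M sI; lia.
have /properP[_ [x]] := grid_proper ki nG.
rewrite !inE => /andP[xK xL]; rewrite xL andbT => xKi.
suff : (i < rk M (K i.+1 :&: (K i :|: L j)))%N by lia.
by rewrite -{1}rKi; apply: flat_rk_lt (xKi) sI; rewrite !inE xK xL orbT.
Qed.

Lemma rk_grid_le i j : (k <= i <= n)%N -> (l <= j <= n)%N ->
  (rk M (G i j) + rk M (K i :|: L j) <= i + j)%N.
Proof.
by move=> ki lj; have := rk_submod M (K i) (L j); rewrite rkK // rkL // addnC.
Qed.

Lemma modular_gridE i j : (k <= i <= n)%N -> (l <= j <= n)%N ->
  modular_pair (K i) (L j) = (i + j == rk M (K i :|: L j) + rk M (G i j))%N.
Proof. by move=> ki lj; rewrite modular_pairE rkK // rkL. Qed.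

Lemma modular_hgood :
  (forall i j, (k <= i <= n)%N -> (l <= j <= n)%N -> modular_pair (K i) (L j)) ->
  forall i, (k <= i < n)%N -> hgood i.
Proof.
move=> mod i ki j lj; apply/wcovby_rkP; split; first exact: (grid_subl L covK).
have ki1 : (k <= i.+1 <= n)%N by lia.
have ki0 : (k <= i <= n)%N by lia.
have := mod _ _ ki0 lj; have := mod _ _ ki1 lj; rewrite !modular_gridE //.
have : (rk M (K i :|: L j) <= rk M (K i.+1 :|: L j))%N.
  by apply/rk_mono/setSU/covby_sub/covK.
lia.
Qed.

(** Descend from the modular pair [(K n, L j)]. When [i] drops by one, [rk_union_step] shows that
    the ranks of union and meet lose at most one in total; [rk_grid_le] is the reverse bound. *)
Lemma hgood_modular : (forall i, (k <= i < n)%N -> hgood i) ->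
  forall i j, (k <= i <= n)%N -> (l <= j <= n)%N -> modular_pair (K i) (L j).
Proof.
move=> hg i j ki lj; move: i ki; apply: down_ind => [|i ki IH].
  rewrite modular_gridE ?leqnn ?le_kn // (grid_nL covL eqKL) // rkL //.
  have -> : K n :|: L j = K n.
    by apply/setUidPl; rewrite -(grid_nL covL eqKL lj) subsetIl.
  by rewrite rkK ?leqnn ?le_kn.
have ki1 : (k <= i.+1 <= n)%N by lia.
have ki0 : (k <= i <= n)%N by lia.
move: IH; rewrite !modular_gridE // => IH.
have := rk_grid_le ki0 lj; have := rk_union_step j ki.
move: IH; have /orP[/eqP<-|cG] := hg i ki j lj; first by rewrite eqxx /=; lia.
rewrite (covby_neq cG) addn1 ltnS; have := covby_rk cG; lia.
Qed.

(** * The function [sigma] and the steps of the grid *)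

Lemma Eblock_sub j : (l <= j)%N -> Eblock l L j \subset L j.
Proof. by rewrite /Eblock; case: eqP => [->|_ _] //; exact: subsetDl. Qed.

Lemma Eblock_cover j x : (l <= j <= n)%N -> x \in L j ->
  exists2 j', (l <= j' <= j)%N & x \in Eblock l L j'.
Proof.
elim: j => [|j IH] /andP[lj jn] xL.
  by exists 0%N; rewrite ?lj // /Eblock; move: lj; rewrite leqn0 => /eqP l0; rewrite l0 eqxx.
have [xj|xj] := boolP ((l <= j)%N && (x \in L j)).
  case/andP: xj => lj' xj; have [|j' ? ?] := IH _ xj; first by lia.
  by exists j' => //; lia.
exists j.+1; first by rewrite lj leqnn.
rewrite /Eblock; case: eqP => [<- //|nl]; rewrite inE xL andbT /=.
by apply: contra xj => ->; rewrite andbT; lia.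
Qed.

(** [find] returns the default [n.+1] on failure, so the bound says that the search succeeded. *)
Lemma sigmaP i : (sigma i <= n)%N ->
  (l <= sigma i)%N /\ exists x, x \in Dblock K i :&: Eblock l L (sigma i).
Proof.
rewrite /sigmaKL; set p := [pred j | _] => le.
have hasp : has p (iota 0 n.+1) by rewrite has_find size_iota ltnS.
by have := nth_find 0%N hasp; rewrite nth_iota ?ltnS // add0n => /andP[-> /set0Pn].
Qed.

(** The points of [G i.+1 j] outside [G i j] form [Dblock K i.+1 :&: L j], and [L j] is the union of
    the blocks [Eblock l L j'] with [l <= j' <= j]. *)
Lemma sigma_le i j : (k <= i < n)%N -> (l <= j <= n)%N ->
  (sigma i.+1 <= j)%N = (G i j != G i.+1 j).
Proof.
move=> ki lj; apply/idP/idP => [sj|nG].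
  have [|ls [x]] := @sigmaP i.+1; first by lia.
  rewrite !inE => /andP[/andP[xKi xK] xE].
  have xL : x \in L j.
    apply: (subsetP (covby_chain covL ls _)); first by lia.
    exact: (subsetP (Eblock_sub ls)).
  apply/eqP => /(congr1 val)/setP/(_ x).
  by rewrite !inE xL xK (negPf xKi).
have /properP[_ [x]] := grid_proper ki nG.
rewrite !inE => /andP[xK xL]; rewrite xL andbT => xKi.
have [j' lj' xE] := Eblock_cover lj xL.
rewrite leqNgt; apply/negP => js; have j's : (j' < sigma i.+1)%N by lia.
have := before_find 0%N j's; rewrite nth_iota ?add0n /=; last by lia.
move/negP; apply; apply/andP; split; first by lia.
by apply/set0Pn; exists x; rewrite !inE xK xKi xE.
Qed.

Lemma sigma_bounds i : (k <= i < n)%N -> (l <= sigma i.+1 <= n)%N.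
Proof.
move=> ki; suff sn : (sigma i.+1 <= n)%N by rewrite sn; case: (sigmaP sn) => ->.
rewrite sigma_le ?leqnn ?le_ln // !(grid_Kn covK eqKL); try lia.
exact/covby_neq/covK.
Qed.

(** By minimality of [sigma i.+1] the block [Dblock K i.+1] misses the preceding [L j]. The
    right-hand side is the set counted by the relation. *)
Lemma Dblock_Eblock i : (k <= i < n)%N -> (l < sigma i.+1)%N ->
  Dblock K i.+1 :&: Eblock l L (sigma i.+1) =
  G i.+1 (sigma i.+1) :\: G i (sigma i.+1).
Proof.
move=> ki ls; have sb := sigma_bounds ki; move: ls sb (sigma_le (j := (sigma i.+1).-1) ki).
case: (sigma i.+1) => // j lj sb e.
have /eqP/(congr1 val)/setP eG : G i j == G i.+1 j.
  by apply/negbFE; rewrite -e /= ?ltnn //; lia.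
have sL : L j \subset L j.+1 by apply: (covby_chain covL); lia.
apply/setP => x; have := eG x; have := subsetP sL x.
rewrite /Dblock /Eblock /= gtn_eqF // !inE.
by case: (x \in K i); case: (x \in K i.+1); case: (x \in L j); case: (x \in L j.+1) => //= /(_ isT).
Qed.

(** [G i.+1 j = G i j] lies in [G i j.+1], and both are covered by [G i.+1 j.+1]; hence they
    coincide. *)
Lemma sigma_eqS i j : (k <= i < n)%N -> (l <= j < n)%N -> vgood i.+1 -> hgood i ->
  sigma i.+1 = j.+1 ->
  [/\ G i j = G i.+1 j, G i j.+1 = G i.+1 j & G i.+1 j != G i.+1 j.+1].
Proof.
move=> ki lj vg hg sj.
have lj1 : (l <= j.+1 <= n)%N by lia.
have lj0 : (l <= j <= n)%N by lia.
have eG : G i j = G i.+1 j by apply/eqP/negbFE; rewrite -sigma_le // sj ltnn.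
have nG : G i j.+1 != G i.+1 j.+1 by rewrite -sigma_le // sj.
have cG : covby (G i j.+1) (G i.+1 j.+1).
  by have := hg _ lj1; rewrite /wcovby (negPf nG).
have sG : G i.+1 j \subset G i j.+1 by rewrite -eG; exact: (grid_subr K covL).
have nG' : G i.+1 j != G i.+1 j.+1.
  apply: contra nG => /eqP e; apply/eqP/(flat_le_rk _) => //.
    exact: covby_sub.
  by rewrite -e; exact: rk_mono.
have cG' : covby (G i.+1 j) (G i.+1 j.+1).
  by have := vg _ lj; rewrite /wcovby (negPf nG').
by split=> //; rewrite (covby_sub_eq cG' sG (covby_sub cG) nG).
Qed.

Lemma square_coefE i j : (k <= i < n)%N -> (l <= j < n)%N -> vgood i.+1 -> hgood i ->
  square_coef K L i j =
  (if sigma i.+1 == j.+1 then #|Dblock K i.+1 :&: Eblock l L (sigma i.+1)|%:Z else 1)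
  * (-1) ^+ ((sigma i.+1 <= j)%N && (G i.+1 j != G i.+1 j.+1)).
Proof.
move=> ki lj vg hg; rewrite /square_coef /corner_coef.
have lj1 : (l <= j.+1 <= n)%N by lia.
have lj0 : (l <= j <= n)%N by lia.
rewrite -(sigma_le ki lj1); have sj := sigma_le ki lj0.
case: (ltngtP (sigma i.+1) j.+1) => [sj1|sj1|sj1] /=; last first.
- have ls : (l < sigma i.+1)%N by rewrite sj1; lia.
  have [_ eA nG] := sigma_eqS ki lj vg hg sj1.
  by rewrite (Dblock_Eblock ki ls) sj1 ltnn expr0 mulr1 eA nG eqxx -eA.
- by rewrite mul1r leqNgt (ltnW sj1) expr0.
rewrite mul1r (sj1 : (sigma i.+1 <= j)%N) /=; case: eqP => // /eqP nG'; rewrite expr1.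
have cG' : covby (G i.+1 j) (G i.+1 j.+1).
  by have := vg _ lj; rewrite /wcovby (negPf nG').
(* If the two inner corners agreed, their meet [G i j] would be [G i.+1 j], against
   [sigma i.+1 <= j]. *)
case: eqP => // e; move: sj; rewrite -ltnS sj1 => /esym/negP[].
by rewrite -(grid_meet covK covL ki lj) e flatI_sub.
Qed.

(** A square with [j.+1 = sigma i.+1] occurs in the column exactly when [l < sigma i.+1], which is
    the restriction on the product of cardinalities. *)
Lemma column_coefE i : (k <= i < n)%N -> vgood i.+1 -> hgood i ->
  \prod_(l <= j < n) square_coef K L i j =
  (if (l < sigma i.+1)%N then #|Dblock K i.+1 :&: Eblock l L (sigma i.+1)|%:Z else 1)
  * (-1) ^+ (\sum_(l <= j < n) ((sigma i.+1 <= j)%N && (G i.+1 j != G i.+1 j.+1))).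
Proof.
move=> ki vg hg; rewrite (eq_big_nat _ _ (fun j lj => square_coefE ki lj vg hg)) big_split /=.
rewrite expr_sum; congr (_ * _); rewrite -big_mkcond /=.
have := sigma_bounds ki; case: (sigma i.+1) => [|s] ls.
  by rewrite big_pred0.
rewrite (eq_bigl (pred1 s)) => [|j]; last by rewrite eqSS eq_sym.
by rewrite big_nat1_eq ltnS; case/andP: ls => _ ->; rewrite andbT.
Qed.

(** * The double coset attached to a pair of flags *)

Section DoubleCosetOfFlags.
Hypothesis hg : forall i, (k <= i < n)%N -> hgood i.

Let vg i : (k <= i <= n)%N -> vgood i.
Proof.
move=> ki; have [|//] := sweep le_kn le_ln covK covL eqKL ki.
by move=> i' ?; apply: hg; lia.
Qed.

Let vgS i : (k <= i < n)%N -> vgood i.+1.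
Proof. by move=> ?; apply: vg; lia. Qed.

(** The value [j.+1] at [i] makes the vertical step above [j] strict in column [i.+1]. The same
    value at a later [i'] makes it degenerate in column [i'], hence also after intersecting with
    [K i.+1]. *)
Lemma sigma_inj i i' : (k <= i < n)%N -> (k <= i' < n)%N ->
  (l < sigma i.+1)%N -> sigma i.+1 = sigma i'.+1 -> i = i'.
Proof.
wlog ii' : i i' / (i <= i')%N.
  move=> H ki ki' ls e; have [|] := leqP i i'; first by move=> ?; apply: H.
  by move/ltnW => ?; apply/esym/H; rewrite -?e.
move=> ki ki'; move: ii'; rewrite leq_eqVlt => /orP[/eqP //|ii'].
have sb := sigma_bounds ki; case es : (sigma i.+1) sb => [|j] // sb ls /esym es'.
have lj : (l <= j < n)%N by lia.
have [_ _ /negP[]] := sigma_eqS ki lj (vgS ki) (hg ki) es.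
have [e1 e2 _] := sigma_eqS ki' lj (vgS ki') (hg ki') es'.
have sK : K i.+1 \subset K i' by apply: (covby_chain covK); lia.
rewrite -e1 in e2; have /setP e := congr1 val e2.
apply/eqP/val_inj/setP => x; have := e x; have := subsetP sK x; rewrite !inE.
by case: (x \in K i.+1) => //= /(_ isT) ->.
Qed.

Lemma double_coset_ex : exists w : 'S_n, w \in double_coset_of k l n sigma.
Proof.
(* Where [sigma i.+1 = l], the rank of [G i l] rises strictly and stays at most [l], so it supplies
   distinct values below [l]. *)
pose g i := if (l < sigma i.+1)%N then (sigma i.+1).-1 else rk M (G i l).
have ll : (l <= l <= n)%N by rewrite leqnn.
have gl i : (k <= i < n)%N -> ~~ (l < sigma i.+1)%N -> (rk M (G i l) < rk M (G i.+1 l))%N.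
  move=> ki; rewrite -leqNgt sigma_le // => nG.
  by apply: flat_proper_rk; exact: grid_proper.
have gl' i : (rk M (G i l) <= l)%N.
  by rewrite -[leqRHS](rkL ll); apply: rk_mono; exact: subsetIr.
have gn i : (k <= i < n)%N -> (g i < n)%N.
  move=> ki; rewrite /g; have := sigma_bounds ki; case: ifP => [ls sb|/negbT ls sb]; first by lia.
  by have := gl _ ki ls; have := gl' i.+1; lia.
have ginj i i' : (k <= i < n)%N -> (k <= i' < n)%N -> (i < i')%N -> g i != g i'.
  move=> ki ki' ii'; rewrite /g.
  case: ifP => [ls|/negbT ls]; case: ifP => [ls'|/negbT ls'].
  - apply/eqP => e; have := @sigma_inj i i' ki ki' ls; lia.
  - by have := gl _ ki' ls'; have := gl' i'.+1; lia.
  - by have := gl _ ki ls; have := gl' i.+1; lia.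
  - have : (rk M (G i.+1 l) <= rk M (G i' l))%N.
      by apply/rk_mono/setSI/(covby_chain covK); lia.
    by have := gl _ ki ls; lia.
(* The default of [insubd] is not taken for [k <= i], since then [g i < n]. *)
pose f (i : 'I_n) := insubd i (g i).
have fE (i : 'I_n) : (k <= i)%N -> f i = g i :> nat.
  by move=> ki; rewrite val_insubd gn ?ki ?ltn_ord.
have injf : {in [set i : 'I_n | (k <= i)%N] &, injective f}.
  move=> i i'; rewrite !inE => ki ki' /(congr1 val) /=; rewrite !fE // => e.
  have [ii' | ii' | /val_inj//] := ltngtP i i'.
    by have := ginj _ _ _ _ ii'; rewrite e eqxx ki ki' !ltn_ord => /(_ isT isT).
  by have := ginj _ _ _ _ ii'; rewrite e eqxx ki ki' !ltn_ord => /(_ isT isT).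
have [w wf] := perm_extend injf; exists w; apply/double_cosetP => i ki.
have ki' : (k <= i < n)%N by rewrite ki ltn_ord.
rewrite wf ?inE // fE // /g; case: ifP => [ls|/negbT ls]; first by rewrite ?ls prednK //; lia.
by rewrite ?(negPf ls); have := gl _ ki' ls; have := gl' i.+1; lia.
Qed.

Section Representative.
Variable w : 'S_n.
Hypothesis wC : w \in double_coset_of k l n sigma.

Lemma sigma_rep (i j : 'I_n) : (k <= i)%N -> (l <= j)%N ->
  w i = j <-> sigma i.+1 = j.+1.
Proof.
move=> ki lj; have := double_cosetP _ _ _ _ wC i ki; case: ifP => ls wi.
  by rewrite -wi; split=> [->|[/val_inj]].
split=> [e|e]; first by move: wi; rewrite e; lia.
by move: ls; rewrite e; lia.
Qed.

(** In column [n] every vertical step is a cover. Going left, a degenerate step stays degenerate,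
    and a strict one degenerates exactly on reaching the column [i] with [w i = j]. *)
Lemma grid_strict_rep i (j : 'I_n) : (k <= i <= n)%N -> (l <= j)%N ->
  (G i j != G i j.+1) = ((w^-1)%g j < i)%N.
Proof.
move=> ki lj; move: i ki; apply: down_ind => [|i ki IH].
  have jn := ltn_ord j; rewrite ltn_ord !(grid_nL covL eqKL); try lia.
  by apply/covby_neq/covL; rewrite lj.
have ljn : (l <= j < n)%N by rewrite lj ltn_ord.
have lj1 : (l <= j.+1 <= n)%N by lia.
have lj0 : (l <= j <= n)%N by lia.
have [kin io] := andP ki; pose o := Ordinal io.
have [e|nV] := eqVneq (G i.+1 j) (G i.+1 j.+1).
  move: IH; rewrite e eqxx => /esym/negbT; rewrite -leqNgt => ia.
  rewrite [RHS]ltnNge ltnW //=; apply/negbTE; rewrite negbK; apply/eqP.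
  rewrite -(grid_meet covK covL ki ljn) e flatI_sub //.
  exact: (grid_subl L covK).
have [ei|ni] := eqVneq ((w^-1)%g j) o.
  have /sigma_rep es : w o = j by rewrite -ei permKV.
  have [-> -> _] := sigma_eqS ki ljn (vgS ki) (hg ki) (es kin lj).
  by rewrite eqxx ei ltnn.
have -> : ((w^-1)%g j < i)%N.
  by move: IH; rewrite nV ltnS leq_eqVlt -[i]/(val o) val_eqE (negPf ni).
(* A strict right side with a degenerate left side forces [sigma i.+1 = j.+1], which [ni]
   excludes. *)
apply/eqP => e.
have [sj|js|es] := ltngtP (sigma i.+1) j.+1.
- have nG : G i j.+1 != G i.+1 j.+1 by rewrite -sigma_le // ltnW.
  have cG : covby (G i j.+1) (G i.+1 j.+1).
    by have := hg ki lj1; rewrite /wcovby (negPf nG).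
  have sG : G i j.+1 \subset G i.+1 j by rewrite -e; exact: (grid_subl L covK).
  have /negP[] : G i j != G i.+1 j by rewrite -sigma_le.
  by rewrite e (covby_sub_eq cG sG) // (grid_subr K covL).
- have e1 : G i j.+1 = G i.+1 j.+1 by apply/eqP/negbFE; rewrite -sigma_le // leqNgt js.
  have e0 : G i j = G i.+1 j by apply/eqP/negbFE; rewrite -sigma_le // leqNgt ltnW.
  by rewrite -e0 -e1 e eqxx in nV.
- by case/eqP: ni; have /sigma_rep <- // : sigma (val o).+1 = j.+1 by []; rewrite permK.
Qed.

(** The right-hand side is independent of [w], as [min_rep_length] requires, and is the total
    exponent of -1 in the sweep. *)
Lemma card_outer_inv_sigma : #|outer_inv k l w| =
  (\sum_(k <= i < n) \sum_(l <= j < n)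
     ((sigma i.+1 <= j) && (G i.+1 j != G i.+1 j.+1)))%N.
Proof.
rewrite card_outer_inv [RHS]big_geq_mkord; apply: eq_bigr => i /= ki.
rewrite [RHS]big_geq_mkord; apply: eq_bigr => j /= lj; congr (nat_of_bool _).
have ki1 : (k <= i < n)%N by rewrite ki ltn_ord.
have -> : (w i < j)%N = (sigma i.+1 <= j)%N.
  have := double_cosetP _ _ _ _ wC i ki; have := sigma_bounds ki1.
  by case: ifP => [ls _ <-|ls sb wi]; lia.
have [sj|//] := boolP (sigma i.+1 <= j)%N.
rewrite grid_strict_rep //=; last by lia.
(* The bounds [< i.+1] and [< i] differ only if [w i = j], and then [sigma i.+1 = j.+1] contradicts
   [sj]. *)
rewrite ltnS [RHS]leq_eqVlt; case: eqP => // /val_inj e.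
have /sigma_rep es : w i = j by rewrite -e permKV.
by move: sj; rewrite es // ltnn.
Qed.

End Representative.

End DoubleCosetOfFlags.

End Modular.

(** * Assembling the vanishing case and the product formula *)

Theorem proposition8p1 (E : finType) (M : matroid E) (k l n : nat)
    (K L : nat -> flat M)
    (le_kn : (k <= n)%N) (le_ln : (l <= n)%N)
    (covK : forall i, (k <= i < n)%N -> covby (K i) (K i.+1))
    (covL : forall j, (l <= j < n)%N -> covby (L j) (L j.+1))
    (eqKL : K n = L n)
    (rkK : forall i, (k <= i <= n)%N -> rk M (K i) = i)
    (rkL : forall j, (l <= j <= n)%N -> rk M (L j) = j) :
  let P := to_Stilde (path_elt (flag_pair_seq k l n K L)) in
  let sigma := sigmaKL l n K L in
  let F := corner_seq k l n K L in
  ((exists i j, [/\ (k <= i <= n)%N, (l <= j <= n)%N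
                  & ~~ modular_pair (K i) (L j)]) ->
     P = 0 /\ to_Salg P = 0)
  /\
  ((forall i j, (k <= i <= n)%N -> (l <= j <= n)%N ->
      modular_pair (K i) (L j)) ->
     [/\ is_double_coset k l (double_coset_of k l n sigma),
         is_flag_path F
       & forall w : 'S_n, is_min_rep (double_coset_of k l n sigma) w ->
         let c := (-1) ^+ (w : bool) *
           (\prod_(k.+1 <= i < n.+1 | (l < sigma i)%N)
              #|Dblock K i :&: Eblock l L (sigma i)|)%N%:Z in
         P = to_Stilde (path_elt F) *~ c
         /\ to_Salg P = to_Salg (to_Stilde (path_elt F)) *~ c]).
Proof.
move=> P sigma F.
have kk : (k <= k <= n)%N by rewrite leqnn.
have eP := path_elt_flag_pair le_kn le_ln covK covL eqKL; rewrite -/P in eP.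
split=> [[i [j [ki lj /negP nmod]]] | mod].
  suff P0 : P = 0 by rewrite P0 raddf0.
  (* If no square vanishes, [hgood_modular] makes every pair modular, against [nmod]. *)
  have [hg | e0] := sweep0 le_kn le_ln covK covL eqKL kk.
    by case: nmod; apply: (hgood_modular le_kn le_ln covK covL eqKL rkK rkL hg).
  by rewrite eP e0 mulr0.
have hg : forall i, (k <= i < n)%N -> hgood l n K L i.
  exact: (modular_hgood le_kn le_ln covK rkK rkL mod).
have [Fpath eF] := corner_seqP le_kn le_ln covK covL eqKL hg.
split=> // [|w wmin c].
  have [w wC] := double_coset_ex le_kn le_ln covK covL eqKL rkL hg.
  exact: double_coset_of_mem wC.
suff e : P = to_Stilde (path_elt F) *~ c by split; rewrite // e raddfMz.
have vg i : (k <= i < n)%N -> vgood l n K L i.+1.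
  move=> ki; have ki1 : (k <= i.+1 <= n)%N by lia.
  have [|//] := sweep le_kn le_ln covK covL eqKL ki1.
  by move=> i' ?; apply: hg; lia.
have [_ e] := sweep le_kn le_ln covK covL eqKL kk hg.
rewrite eP e mulrzAr -eF; congr (_ *~ _).
under eq_big_nat => i ki.
  rewrite (column_coefE le_kn le_ln covK covL eqKL ki (vg i ki) (hg i ki)); over.
(* The exponents of -1 add up to the number of outer inversions of any element of the double coset,
   which is the length of [w]. *)
rewrite big_split /= -expr_sum mulrC /c; congr (_ * _).
  rewrite sign_perm_length; congr (_ ^+ _); apply/esym.
  apply: min_rep_length wmin => u uC.
  exact: (card_outer_inv_sigma le_kn le_ln covK covL eqKL hg uC).
by rewrite -big_mkcond /= (big_morph Posz PoszM (erefl _)) big_add1.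
Qed.
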